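(* There exist constants $\gamma,\gamma'>0$ such that for every $\varepsilon$ with $0<\varepsilon<1/2$ the following holds: for all $n$ large enough, if $k$ is chosen uniformly at random from the integers $\{2,3,\ldots,n-2\}$, then with probability at least $\gamma$ (over the choice of $k$) the Markov chain $X$ on the $n$-cycle with added edge $(k,n)$ described in the context satisfies $$t_{\rm mix}(X,\varepsilon)\le \gamma' n^{3/2}\log\frac1\varepsilon .$$
   Context: The Markov chain. Let $V=\{1,2,\ldots,n\}$ be the vertices of a cycle and $2\le k\le n-2$ an integer. Write $a_i=i$ for $1\le i\le k$ (arc $A$) and $b_j=k+j$ for $1\le j\le n-k$ (arc $B$). The vertices $a_k=k$ and $b_{n-k}=n$ are called hubs, and an edge between them is added. The chain $X(t)$, $t=0,1,2,\ldots$, on $V$ has transition probabilities - $P(a_i,a_{i+1})=P(b_j,b_{j+1})=1/2$ for $1\le i\le k-1$, $1\le j\le n-k-1$; - $P(a_k,b_1)=P(b_{n-k},a_1)=1/2$; - $P(a_i,a_i)=P(b_j,b_j)=1/2$ for $1\le i\le k-1$, $1\le j\le n-k-1$; - $P(a_k,a_k)=P(a_k,b_{n-k})=P(b_{n-k},a_k)=P(b_{n-k},b_{n-k})=1/4$; and all other entries are $0$. The unique stationary distribution is the uniform distribution $\pi$ on $V$. Mixing time. For probability distributions $\mu,\sigma$ on $V$, $\|\mu-\sigma\|_{\rm TV}=\frac12\sum_{x\in V}|\mu(x)-\sigma(x)|$. Let $\mathcal L(X(t))$ be the law of $X(t)$, $d_X(t)=\sup_{X(0)\in V}\|\mathcal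 L(X(t))-\pi\|_{\rm TV}$ (supremum over deterministic starting vertices), and $t_{\rm mix}(X,\varepsilon)=\min\{t: d_X(t)\le\varepsilon\}$. *)

(* Defs.v *)
From mathcomp Require Import all_boot all_order all_algebra.
From mathcomp Require Import all_classical all_reals all_analysis.
Set Implicit Arguments.
Unset Strict Implicit.
Unset Printing Implicit Defensive.
Import Order.TTheory GRing.Theory Num.Theory.
Local Open Scope ring_scope.

(* Vertices are labelled 1, ..., n.  The arc A is 1, ..., k, with hub k, and  *)
(* the arc B is k.+1, ..., n, with hub n.                                     *)
Definition is_hub (n k x : nat) : bool := (x == k) || (x == n).

Definition next_label (n x : nat) : nat := if x == n then 1%N else x.+1.

(* For 2 <= k <= n - 2 the two hubs are not adjacent on the cycle, so the     *)
(* order of the tests is immaterial; the second one also covers the holding   *)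
(* probability 1/4 at a hub.                                                  *)
Definition trans_prob (R : realType) (n k x y : nat) : R :=
  if y == next_label n x then 1 / 2
  else if is_hub n k x && is_hub n k y then 1 / 4
  else if y == x then 1 / 2
  else 0.

(* The index i : 'I_n stands for the vertex labelled i.+1.                    *)
Definition trans_mx (R : realType) (n k : nat) : 'M[R]_n :=
  \matrix_(i < n, j < n) trans_prob R n k i.+1 j.+1.

Definition chain_law (R : realType) (n k : nat) (x : 'I_n) (t : nat) : 'rV[R]_n :=
  delta_mx 0 x *m trans_mx R n k ^+ t.

Definition unif_dist (R : realType) (n : nat) : 'rV[R]_n := const_mx n%:R^-1.

Definition tv_dist (R : realType) (n : nat) (mu sigma : 'rV[R]_n) : R :=
  1 / 2 * \sum_(x < n) `|mu 0 x - sigma 0 x|.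

Definition chain_dist (R : realType) (n k t : nat) : R :=
  \big[Num.max/0]_(x < n) tv_dist (chain_law R k x t) (unif_dist R n).

(* The least t with chain_dist t <= eps; it is +oo if there is no such t.     *)
Definition t_mix (R : realType) (n k : nat) (eps : R) : \bar R :=
  ereal_inf [set (t%:R)%:E | t in [set t : nat | chain_dist R n k t <= eps]].

(* Probability of E under the uniform distribution on the entries of a        *)
(* nonempty duplicate-free list s.                                            *)
Definition unif_prob (R : realType) (T : Type) (s : seq T) (E : pred T) : R :=
  (count E s)%:R / (size s)%:R.

(* Main.v *)
Require Import Defs.
From mathcomp Require Import all_boot all_order all_algebra.
From mathcomp Require Import all_fingroup.
From mathcomp Require Import all_classical all_reals all_analysis.
From mathcomp Require Import zify ring lra.
Import Order.TTheory GRing.Theory Num.Theory.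
Local Open Scope ring_scope.

(** A step of the chain is a move along the cycle with probability 1/2, and an
idle step otherwise, where idling at a hub puts the walker on one of the two
hubs with equal probability.  Run the chain for [T] of order [n^(3/2)].  The
walker then completes about [sqrt n] arcs, and two independent effects spread
it out: the number of moves made in time [T] fluctuates by [sqrt T], which is
of order [n^(3/4)], and the surplus of completed arcs A over completed arcs B
fluctuates by [n^(1/4)].  Going round A instead of B moves the walker by [k]
modulo [n], so the second effect scatters it over the multiples [u * k] modulo
[n] with [u] up to [n^(1/4)].  When these multiples leave no gap larger than
[n^(3/4)], the first effect fills the gaps, and [P^T x y >= c / n] for all
[x] and [y].  A chain with this property loses a fixed fraction of its
distance to the uniform distribution every [T] steps, whence the bound
[C * T * ln (1 / eps)] on the mixing time.

The density of the multiples fails only if [b * k] is within [n^(3/4)] of a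
multiple of [n] for some [b] below a small multiple of [n^(1/4)]
([multiples_dense], which rests on Dirichlet's approximation theorem and on
the invertibility of [a] modulo [b] for the approximating fraction [a / b]).
A union bound over these [b] leaves most values of [k] ([count_approximable]).

The lower bound on [P^T x y] comes from one class of trajectories, those that
complete [p] arcs A and [q] arcs B before entering the arc of [y].  Their
total probability does not simply factor into a binomial probability for the
number of moves and a probability for the pair [(p, q)], because a turn at a
hub depends on the time spent there.  But a walker who idles at least once at a
hub takes a fair coin to choose the next arc, one who does not idle goes to the
other arc, and once it is known at which [i] of the [h] hubs visited the
walker idled, the number of ways to place the moves in time is a single binomial
coefficient, whose value hardly depends on [i] ([walk_ge],
[path_weight_ge]).  What remains is the law of [(p, q)] when the turns are
independent with these probabilities ([arc_law_ge]): between two coins the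
arcs alternate, so a stretch with an odd number of arcs contributes a fair
sign to [p - q], a stretch with an even number contributes nothing, and
[p - q] is a sum of fair signs whose number is usually a positive fraction of
[h]. *)

(** * Binomial coefficients near the centre *)

(** Induction on [m]: [C(2m, m)^2 * 4m / 16^m] increases with [m],
because [4 * (m + 1) * (m + 2) <= (2 * m + 3)^2]. *)
Lemma central_bin_sqr (m : nat) :
  (0 < m)%N -> (16 ^ m <= 'C(m.*2, m) ^ 2 * (4 * m))%N.
Proof.
elim: m => // -[_ _|m IHm _]; first by [].
have {}IHm := IHm isT.
have E : (m.+2 * 'C(m.+2.*2, m.+2) = 2 * (m.+1.*2.+1) * 'C(m.+1.*2, m.+1))%N.
  have E1 := mul_bin_diag m.+1.*2.+2 m.+1.
  have E2 := mul_bin_down m.+1.*2.+1 m.+1.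
  rewrite /= in E1 E2.
  have e : (m.+1.*2.+1 - m.+1 = m.+2)%N by lia.
  rewrite e in E2.
  rewrite (_ : m.+2.*2 = m.+1.*2.+2)%N; last by lia.
  rewrite -E1 (_ : m.+1.*2.+2 = 2 * m.+2)%N; last by lia.
  by rewrite -mulnA -E2 mulnA.
set a := 'C(_, _) in E *; set b := 'C(_, _) in E IHm.
suff: (16 ^ m.+2 * (m.+1 * m.+2 ^ 2) <= a ^ 2 * (4 * m.+2) * (m.+1 * m.+2 ^ 2))%N.
  by rewrite leq_pmul2r.
have -> : (a ^ 2 * (4 * m.+2) * (m.+1 * m.+2 ^ 2) =
           (m.+2 * a) ^ 2 * (4 * m.+2) * m.+1)%N by ring.
rewrite E expnS.
have -> : ((2 * m.+1.*2.+1 * b) ^ 2 * (4 * m.+2) * m.+1 =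
  (b ^ 2 * (4 * m.+1)) * (4 * (m.+1.*2.+1) ^ 2 * m.+2))%N by ring.
rewrite (mulnC 16%N) -mulnA; apply: leq_mul => //.
rewrite (_ : 16 * (m.+1 * m.+2 ^ 2) = 4 * (4 * (m.+1 * m.+2)) * m.+2)%N; last by ring.
rewrite leq_mul2r leq_mul2l -muln2 /=.
have -> : ((m.+1 * 2).+1 ^ 2 = 4 * (m.+1 * m.+2) + 1)%N by ring.
by rewrite leq_addr.
Qed.

(** The ratio of consecutive coefficients is at least [1 - (2 * i + 1) / m], and
[(1 - i^2 / m) * (1 - (2 * i + 1) / m) >= 1 - (i + 1)^2 / m]. *)
Lemma near_central_bin (m i : nat) :
  ('C(m.*2, m) * (m - i ^ 2) <= 'C(m.*2, m + i) * m)%N.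
Proof.
elim: i => [|i IHi]; first by rewrite addn0 subn0.
case: (leqP (i.+1 ^ 2) m) => him; last first.
  by rewrite (_ : m - _ = 0)%N ?muln0 //; lia.
have E := mul_bin_left m.*2 (m + i).
have e : (m.*2 - (m + i) = m - i)%N by lia.
rewrite e -addnS in E.
set a := 'C(_, m) in IHi *; set b := 'C(_, _) in IHi E; set c := 'C(_, _) in E *.
move: him; rewrite -(leq_pmul2l (ltn0Sn (m + i))) => him.
have him' : (i.+1 ^ 2 <= m)%N by rewrite leq_pmul2l in him.
rewrite -(leq_pmul2l (_ : 0 < m + i.+1)%N) ?addnS //.
have -> : ((m + i).+1 * (c * m) = (m - i) * b * m)%N by rewrite -addnS mulnA E; ring.
have le1 : ((m - i) * (a * (m - i ^ 2)) <= (m - i) * b * m)%N.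
  by rewrite -mulnA leq_mul2l IHi orbT.
apply: leq_trans le1.
have -> : ((m + i).+1 * (a * (m - i.+1 ^ 2)) = a * ((m + i).+1 * (m - i.+1 ^ 2)))%N by ring.
have -> : ((m - i) * (a * (m - i ^ 2)) = a * ((m - i) * (m - i ^ 2)))%N by ring.
rewrite leq_mul2l; apply/orP; right.
have [d Ed] : exists d, m = (i.+1 ^ 2 + d)%N by exists (m - i.+1 ^ 2)%N; lia.
rewrite Ed addKn.
rewrite (_ : i.+1 ^ 2 = i ^ 2 + 2 * i + 1)%N; last by ring.
rewrite (_ : i ^ 2 + 2 * i + 1 + d - i ^ 2 = d + 2 * i + 1)%N; last by lia.
rewrite (_ : i ^ 2 + 2 * i + 1 + d - i = d + i ^ 2 + i + 1)%N; last by lia.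
have -> : ((d + i ^ 2 + i + 1) * (d + 2 * i + 1) =
  (i ^ 2 + 2 * i + 1 + d + i).+1 * d + (i ^ 2 + i + 1) * (2 * i + 1))%N by ring.
exact: leq_addr.
Qed.

Section Bin.
Variable R : realFieldType.

Lemma bin_even_ge (m i : nat) (s : R) : (0 < m)%N -> (2 * i ^ 2 <= m)%N ->
  0 < s -> m%:R <= s ^+ 2 -> 2 ^+ m.*2 <= 'C(m.*2, m + i)%:R * (4 * s).
Proof.
move=> m0 him s0 hs.
have H1 := near_central_bin m i; have H2 := central_bin_sqr m m0.
have H3 : ('C(m.*2, m) <= 2 * 'C(m.*2, m + i))%N.
  suff: ('C(m.*2, m) * m <= 2 * 'C(m.*2, m + i) * m)%N by rewrite leq_pmul2r.
  by nia.
have H4 : 2 ^+ m.*2 <= 'C(m.*2, m)%:R * (2 * s).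
  rewrite -ler_sqr ?nnegrE; [|exact: exprn_ge0|by rewrite mulr_ge0 // mulr_ge0 // ltW].
  have -> : (2 ^+ m.*2) ^+ 2 = (16 ^ m)%:R :> R.
    rewrite -exprM natrX -mul2n mulnAC exprM; congr (_ ^+ _); ring.
  apply: le_trans (_ : ('C(m.*2, m) ^ 2 * (4 * m))%:R <= _); first by rewrite ler_nat.
  have -> : ('C(m.*2, m)%:R * (2 * s)) ^+ 2 = ('C(m.*2, m) ^ 2)%:R * (4 * s ^+ 2).
    by rewrite natrX; ring.
  by rewrite natrM ler_wpM2l // natrM ler_wpM2l.
apply: le_trans H4 _.
have : ('C(m.*2, m))%:R <= (2 * 'C(m.*2, m + i))%:R :> R by rewrite ler_nat.
rewrite natrM; nra.
Qed.

(** The two subtractions are truncated: together they bound [|2 * j - r|].  The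
scale [s] stands for the square root of [r]; any upper bound of it will do. *)
Lemma bin_ge (r j : nat) (s : R) : (8 * (j.*2 - r) ^ 2 <= r)%N ->
  (8 * (r - j.*2) ^ 2 <= r)%N -> (0 < r)%N -> 0 < s -> r%:R <= s ^+ 2 ->
  2 ^+ r <= 'C(r, j)%:R * (8 * s).
Proof.
wlog rj : j / (r <= j.*2)%N.
  move=> W h1 h2; case: (leqP r j.*2) => [h|h]; first exact: W.
  have jr : (j <= r)%N by lia.
  rewrite -(bin_sub jr).
  apply: W; first lia.
    by rewrite (_ : (r - j).*2 - r = r - j.*2)%N //; lia.
  by rewrite (_ : r - (r - j).*2 = j.*2 - r)%N //; lia.
move=> h _ r0 s0 hs.
have [m [i [[Er Ej]|[Er Ej]]]] : exists m i, (r = m.*2 /\ j = m + i)%N \/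
    (r = m.*2.+1 /\ j = (m + i).+1)%N.
  exists r./2; case E: (odd r).
    exists (j - r./2.+1)%N; right; lia.
  exists (j - r./2)%N; left; lia.
- have : 2 ^+ m.*2 <= 'C(m.*2, m + i)%:R * (4 * s) :> R.
    apply: bin_even_ge => //; [lia|nia|].
    by apply: le_trans hs; rewrite ler_nat; lia.
  have : 0 <= 'C(m.*2, m + i)%:R :> R by [].
  rewrite Er Ej; nra.
- have m0 : (0 < m)%N by rewrite Er Ej in h; nia.
  have : 2 ^+ m.*2 <= 'C(m.*2, m + i.+1)%:R * (4 * s) :> R.
    apply: bin_even_ge => //; first by rewrite Er Ej in h; nia.
    by apply: le_trans hs; rewrite ler_nat; lia.
  have : 0 <= 'C(m.*2, m + i)%:R :> R by [].
  rewrite Er Ej exprS binS natrD addnS.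
  nra.
Qed.
End Bin.

(** * Walks that go round two arcs *)

Section Lifting.
Variable R : realFieldType.
Implicit Types (c : bool) (p q m t h : nat).

(** Counts of completed arcs are pairs [(p, q)], for A ([c = true]) and B.  In
terms of generating functions in [X] and [Z], [after_arc c] multiplies by [X]
when [c] is A and by [Z] when it is B. *)
Definition after_arc c (F : nat -> nat -> R) p q : R :=
  if c then (if p is p'.+1 then F p' q else 0)
  else (if q is q'.+1 then F p q' else 0).

Lemma after_arc_add c F p q : after_arc c F (p + c) (q + ~~ c) = F p q.
Proof. by case: c => /=; rewrite ?addn1 ?addn0. Qed.

Lemma after_arcP c F p q :
  (exists p' q', [/\ p = p' + c, q = q' + ~~ c & after_arc c F p q = F p' q'])%N \/
  forall F', after_arc c F' p q = 0.
Proof.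
case: c => /=; [case: p => [|p]; [by right|left]|case: q => [|q]; [by right|left]].
  by exists p, q; rewrite addn1 addn0.
by exists p, q; rewrite addn1 addn0.
Qed.

(** Number of words of [t] letters, weighted by the turns, that describe a walk
which has passed [h] hubs, stands on arc [c], and has entered [p] arcs A and [q]
arcs B since the first hub, the current one included.  A letter is a move or an
idle step; the move that leaves a hub is not a letter of its own.  Passing a hub
at once forces the other arc.  Passing it after some idle steps gives each arc
weight 1/2 and inserts a positive number of idle steps; the generating function
[w / (1 - w)] of these insertions leaves the upper index of the binomial
coefficient unchanged and raises the lower one by one. *)
Fixpoint path_weight t c0 h c p q m : R :=
  if h is h'.+1 then
    after_arc c (fun p q => path_weight t c0 h' (~~ c) p q m +
      (path_weight t c0 h' true p q m.+1 + path_weight t c0 h' false p q m.+1) / 2) p q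
  else if [&& c == c0, p == 0%N & q == 0%N] then 'C(t, m)%:R else 0.

(** No walk is that far at the start: this anchors the inductions on time. *)
Lemma path_weight0 c0 h c p q m : path_weight 0 c0 h c p q m.+1 = 0.
Proof.
elim: h c p q m => [|h IHh] c p q m /=; first by rewrite if_same.
case: (after_arcP c (fun p q => path_weight 0 c0 h (~~ c) p q m.+1 +
  (path_weight 0 c0 h true p q m.+2 + path_weight 0 c0 h false p q m.+2) / 2) p q).
  by move=> [p' [q' [_ _ ->]]]; rewrite !IHh; ring.
exact.
Qed.

(** Pascal's rule, which is the recurrence of the chain along an arc: a walker who
did not just move idled at the same place. *)
Lemma path_weightS t c0 h c p q m :
  path_weight t.+1 c0 h c p q m.+1 =
  path_weight t c0 h c p q m.+1 + path_weight t c0 h c p q m.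
Proof.
elim: h c p q m => [|h IHh] c p q m /=.
  by case: ifP; rewrite ?addr0 // binS natrD.
by case: c; [case: p => [|p]|case: q => [|q]]; rewrite /= ?addr0 // !IHh; ring.
Qed.

(** One turn at a hub: with probability 1/2 it is forced to the other arc, with
probability 1/2 it is a fair coin. *)
Definition arc_step (F : bool -> nat -> nat -> R) c : nat -> nat -> R :=
  after_arc c (fun p q => F (~~ c) p q / 2 + (F true p q + F false p q) / 4).

Definition arc_law c0 h : bool -> nat -> nat -> R :=
  iter h arc_step (fun c p q => [&& c == c0, p == 0%N & q == 0%N]%:R).

Lemma arc_lawS c0 h : arc_law c0 h.+1 = arc_step (arc_law c0 h).
Proof. by []. Qed.

(** The time and the choice of arcs separate as soon as the binomial coefficients
that can occur, one for each possible number of coins, have a common lower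
bound. *)
Lemma path_weight_ge t c0 h c p q m (b : R) :
  (forall i, (i <= h)%N -> b <= 'C(t, m + i)%:R) ->
  b * 2 ^+ h * arc_law c0 h c p q <= path_weight t c0 h c p q m.
Proof.
elim: h c p q m => [|h IHh] c p q m hb.
  rewrite /arc_law /=; case: ifP => _; last by rewrite mulr0.
  by rewrite !mulr1; have := hb 0%N isT; rewrite addn0.
rewrite arc_lawS /arc_step /=.
have [[p' [q' [-> -> _]]]|] := after_arcP c (fun _ _ => 0) p q; last first.
  by move=> E; rewrite !E mulr0.
rewrite !after_arc_add exprS.
have b1 : forall i : nat, (i <= h)%N -> b <= 'C(t, m + i)%:R.
  by move=> i ih; apply: hb; rewrite ltnW.
have b2 : forall i : nat, (i <= h)%N -> b <= 'C(t, m.+1 + i)%:R.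
  by move=> i ih; rewrite addSnnS; apply: hb.
have H1 := IHh (~~ c) p' q' m b1.
have H2 := IHh true p' q' m.+1 b2; have H3 := IHh false p' q' m.+1 b2.
lra.
Qed.

(** In this section [g t c e] is [2^t] times the probability of being at position
[e] of arc [c] at time [t]; of the chain only the inequalities that a step
satisfies are kept.  Positions start at 0, so the hub closing arc [c]
is at [(last_pos c).+1], and the walk starts [d0] moves before the position
preceding the hub of [c0]. *)
Section Walk.
Variables (k l e0 d0 : nat) (c0 : bool) (g : nat -> bool -> nat -> R).
Let last_pos c := if c then k else l.
Hypothesis g_ge0 : forall t c e, 0 <= g t c e.
Hypothesis e0d0 : (e0 + d0 = last_pos c0)%N.
Hypothesis g_start : 1 <= g 0 c0 e0.
Hypothesis g_arc : forall t c e, (e < last_pos c)%N ->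
  g t c e.+1 + g t c e <= g t.+1 c e.+1.
Hypothesis g_enter : forall t c,
  g t c 0 + g t (~~ c) (last_pos (~~ c)).+1 <= g t.+1 c 0.
Hypothesis g_hub : forall t c,
  g t c (last_pos c) + (g t true k.+1 + g t false l.+1) / 2 <= g t.+1 c (last_pos c).+1.

(* The number of moves made when the walker reaches the last position before a
   hub, less one move for each hub passed: the move that leaves a hub is not a
   free letter of the word. *)
Let M p q := (d0 + p * k.+1 + q * l.+1)%N.

Lemma g_start_lazy t : 1 <= g t c0 e0.
Proof.
elim: t => [//|t IHt]; case: e0 e0d0 IHt => [|e] He IHt.
  apply: le_trans (g_enter t c0); rewrite -[1]addr0; exact: lerD.
apply: le_trans (g_arc t c0 e _); last by lia.
by rewrite -[1]addr0; exact: lerD.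
Qed.

Lemma g_first_arc t d : (d <= d0)%N -> 'C(t, d)%:R <= g t c0 (e0 + d).
Proof.
elim: d t => [|d IHd] t dd0; first by rewrite bin0 addn0 g_start_lazy.
elim: t => [|t IHt]; first by rewrite bin0n.
rewrite addnS; apply: le_trans (g_arc t c0 _ _); last by lia.
by rewrite binS natrD -addnS; apply: lerD => //; apply: IHd; lia.
Qed.

(** The first term counts the walks that have just arrived at the hub, the second
one those that have idled there and chose this hub. *)
Lemma hub_bound h :
  (forall t c p q, path_weight t c0 h c p q (M p q) <= g (t + h) c (last_pos c)) ->
  forall t c p q, path_weight t c0 h c p q (M p q) +
    (path_weight t c0 h true p q (M p q).+1 + path_weight t c0 h false p q (M p q).+1) / 2
    <= g (t + h).+1 c (last_pos c).+1.
Proof.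
move=> H t; elim: t => [|t IHt] c p q; apply: le_trans (g_hub _ _).
  rewrite !path_weight0 addr0 mul0r addr0.
  by rewrite -[leLHS]addr0; apply: lerD => //; rewrite divr_ge0 ?addr_ge0.
rewrite -addSn; apply: lerD => //.
rewrite !path_weightS.
have H1 := IHt true p q; have H2 := IHt false p q; rewrite /= in H1 H2.
rewrite addSn; lra.
Qed.

(** Entering an arc and each position on it sum the previous position over time,
which raises the index of the binomial coefficients by one. *)
Lemma arc_bound h :
  (forall t c p q, path_weight t c0 h c p q (M p q) +
    (path_weight t c0 h true p q (M p q).+1 + path_weight t c0 h false p q (M p q).+1) / 2
    <= g (t + h).+1 c (last_pos c).+1) ->
  forall e t c p q, (e <= last_pos c)%N ->
   path_weight t c0 h.+1 c (p + c) (q + ~~ c) (M p q + e.+1) <= g (t + h.+1) c e.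
Proof.
move=> H e; elim: e => [|e IHe] t c p q ec.
  rewrite addn1; elim: t => [|t IHt]; first by rewrite path_weight0.
  rewrite path_weightS addSn; apply: le_trans (g_enter _ _).
  apply: lerD => //; rewrite /= after_arc_add addnS; exact: H.
rewrite addnS; elim: t => [|t IHt]; first by rewrite path_weight0.
rewrite path_weightS addSn; apply: le_trans (g_arc _ _ _ _) => //.
by apply: lerD => //; apply: IHe; exact: ltnW.
Qed.

Lemma last_bound h t c p q :
  path_weight t c0 h c p q (M p q) <= g (t + h) c (last_pos c).
Proof.
elim: h t c p q => [|h IHh] t c p q.
  rewrite /= addn0; case: ifP => // /and3P[/eqP-> /eqP-> /eqP->].
  by rewrite /M !mul0n !addn0 -e0d0; exact: g_first_arc.
have [[p' [q' [-> -> _]]]|] := after_arcP c (fun _ _ => 0) p q; last first.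
  by move=> E; rewrite /= E.
have := arc_bound h (hub_bound h IHh) _ t c p' q' (leqnn _).
rewrite (_ : M p' q' + _ = M (p' + c) (q' + ~~ c))%N //.
by rewrite /M /last_pos; case: c => /=; ring.
Qed.

(** [hub_bound] and [arc_bound] alternate along the trajectory. *)
Lemma walk_ge t h c p q e : (e <= last_pos c)%N ->
  path_weight t c0 h.+1 c (p + c) (q + ~~ c) (M p q + e.+1) <= g (t + h.+1) c e.
Proof. exact: arc_bound (hub_bound h (last_bound h)) _ _ _ _ _. Qed.

End Walk.
End Lifting.

(** * The number of rounds on each arc *)

Section Runs.
Variable R : realFieldType.
Implicit Types (c : bool) (p q r i h : nat) (F G : bool -> nat -> nat -> R).

(** Linearity allows the evolution to be decomposed from its first turn on. *)
Lemma iter_arc_step_linear a b h F G c p q :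
  iter h (@arc_step R) (fun c p q => a * F c p q + b * G c p q) c p q =
  a * iter h (@arc_step R) F c p q + b * iter h (@arc_step R) G c p q.
Proof.
elim: h c p q => [//|h IHh] c p q; rewrite !iterS /arc_step.
have [[p' [q' [-> -> _]]]|E] := after_arcP R c (fun _ _ => 0) p q.
  by rewrite !after_arc_add !IHh; field.
by rewrite !E; ring.
Qed.

Lemma iter_arc_step_le h F G c p q : (forall c p q, F c p q <= G c p q) ->
  iter h (@arc_step R) F c p q <= iter h (@arc_step R) G c p q.
Proof.
move=> FG; elim: h c p q => [//|h IHh] c p q; rewrite !iterS /arc_step.
have [[p' [q' [-> -> _]]]|E] := after_arcP R c (fun _ _ => 0) p q.
  rewrite !after_arc_add.
  have H1 := IHh (~~ c) p' q'; have H2 := IHh true p' q'; have H3 := IHh false p' q'.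
  lra.
by rewrite !E.
Qed.

(** The coefficient of [X^p Z^q] in [((X + Z) / 2)^r * (X * Z)^i]: [r] completed
stretches of odd length, whose surplus arcs are fair signs, and [i] pairs of
one arc A and one arc B. *)
Definition runs_coef r i p q : R :=
  if (p + q == r + 2 * i)%N && (i <= p)%N then 'C(r, p - i)%:R / 2 ^+ r else 0.

Lemma runs_coef_ge0 r i p q : 0 <= runs_coef r i p q.
Proof. by rewrite /runs_coef; case: ifP => // _; rewrite divr_ge0 ?exprn_ge0. Qed.

Lemma runs_coef_odd r i p q : runs_coef r.+1 i p q =
  (after_arc R true (runs_coef r i) p q + after_arc R false (runs_coef r i) p q) / 2.
Proof.
have e2 : (2 ^+ r != 0 :> R) by rewrite expf_neq0 // pnatr_eq0.
rewrite /runs_coef /= exprS; case: p => [|p]; case: q => [|q] /=.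
- by rewrite addr0 mul0r.
- rewrite !add0n sub0n !bin0 (_ : (q.+1 == r.+1 + 2 * i)%N = (q == r + 2 * i)%N); last by lia.
  by case: ifP => _; rewrite add0r ?mul0r //; field.
- rewrite !addn0 (_ : (p.+1 == r.+1 + 2 * i)%N = (p == r + 2 * i)%N); last by lia.
  case: eqP => [E|] /=; last by rewrite add0r mul0r.
  rewrite !ifT; [|lia..].
  rewrite addr0; case: i E => [|i] E.
    by rewrite !subn0 E muln0 addn0 !binn; field.
  by rewrite !bin_small ?mul0r //; lia.
- rewrite (_ : (p.+1 + q.+1 == r.+1 + 2 * i)%N = (p + q.+1 == r + 2 * i)%N); last by lia.
  rewrite (_ : (p.+1 + q == r + 2 * i)%N = (p + q.+1 == r + 2 * i)%N); last by lia.
  case: eqP => [E|] /=; last by rewrite add0r mul0r.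
  case: (ltngtP i p.+1) => [ip|ip|->].
  + by rewrite !ifT; [|lia..]; rewrite subSn // binS natrD; field.
  + by rewrite !ifF ?addr0 ?mul0r //; lia.
  + by rewrite ltnn subnn !bin0 add0r; field.
Qed.

Lemma runs_coef_even r i p q : runs_coef r i.+1 p q =
  after_arc R true (after_arc R false (runs_coef r i)) p q.
Proof.
rewrite /runs_coef; case: p => [|p]; rewrite ?andbF //=; case: q => [|q] /=.
  case: eqP => //= E; case: leqP => //= ip.
  by rewrite bin_small ?mul0r //; lia.
rewrite ltnS subSS (_ : (p.+1 + q.+1 == r + 2 * i.+1)%N = (p + q == r + 2 * i)%N) //.
by lia.
Qed.

(** The arcs between two coins form a stretch.  When the current stretch has an odd
number of arcs, it contains one arc more of the kind of its current arc, and
both kinds are equally likely. *)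
Definition after_odd_run r i c p q : R := after_arc R c (runs_coef r i) p q / 2.

(** When the stretch has an even number of arcs its counts are balanced, so the
current arc [c] is independent of them. *)
Definition after_even_run r i c p q : R := runs_coef r i.+1 p q / 2.

(** A coin closes the stretch, and its first arc becomes one more fair sign;
otherwise the stretch becomes even. *)
Lemma arc_step_odd r i c p q : arc_step R (after_odd_run r i) c p q =
  2^-1 * after_odd_run r.+1 i c p q + 2^-1 * after_even_run r i c p q.
Proof.
rewrite /arc_step /after_odd_run /after_even_run runs_coef_even.
have E : after_arc R true (after_arc R false (runs_coef r i)) p q =
    after_arc R c (after_arc R (~~ c) (runs_coef r i)) p q.
  by case: c => //; case: p => [|p]; case: q.
rewrite E; have [[p' [q' [-> -> _]]]|E'] := after_arcP R c (fun _ _ => 0) p q.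
  by rewrite !after_arc_add runs_coef_odd; field.
by rewrite !E'; field.
Qed.

(** Here a coin and a forced turn have the same effect: closing a balanced
stretch adds no sign, and the next arc is fair in either case. *)
Lemma arc_step_even r i c p q :
  arc_step R (after_even_run r i) c p q = after_odd_run r i.+1 c p q.
Proof.
rewrite /arc_step /after_odd_run /after_even_run.
have [[p' [q' [-> -> _]]]|E] := after_arcP R c (fun _ _ => 0) p q.
  by rewrite !after_arc_add; field.
by rewrite !E; field.
Qed.

Lemma iter_after_odd_run h r i c p q :
  iter h.+2 (@arc_step R) (after_odd_run r i) c p q =
  (iter h.+1 (@arc_step R) (after_odd_run r.+1 i) c p q +
   iter h (@arc_step R) (after_odd_run r i.+1) c p q) / 2.
Proof.
have eqI h' F G c' p' q' : (forall c p q, F c p q = G c p q) ->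
    iter h' (@arc_step R) F c' p' q' = iter h' (@arc_step R) G c' p' q'.
  by move=> FG; apply/eqP; rewrite eq_le !iter_arc_step_le // => *; rewrite FG.
rewrite iterSr (eqI _ _ _ _ _ _ (arc_step_odd r i)) iter_arc_step_linear.
rewrite (iterSr h _ (after_even_run r i)) (eqI _ _ _ _ _ _ (arc_step_even r i)).
by field.
Qed.

(** Unfolding [iter_after_odd_run], the number [r] of signs grows by one with
probability 1/2 at the price of one turn, and otherwise two turns are spent.
The bound is the value [b] of a coefficient with enough signs, times a lower
bound for the probability that at least [rho] signs have been collected in the
end.  The latter is a linear function of [h] and [r]: it is at most the
indicator of [rho <= r] when the turns are exhausted, since [r <= Rm], and it
does not exceed the average of its values after the two unfoldings, because the
slope 1/2 in [r] is three times the slope 1/6 in [h]. *)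
Lemma after_odd_run_ge (p q rho Rm : nat) (b : R) h r i c :
  0 <= b -> (0 < Rm)%N ->
  (forall r i, (rho <= r <= Rm)%N -> (p + q = r + 2 * i)%N -> b <= runs_coef r i p q) ->
  (p + q = h + r + 2 * i)%N -> (h + r <= Rm)%N ->
  b / 2 * ((h%:R / 6 + r%:R / 2 - rho%:R / 2) / Rm%:R) <=
  iter h (@arc_step R) (after_odd_run r i) c (p + c) (q + ~~ c).
Proof.
move=> b0 Rm0 Hb; have Rp : 0 < Rm%:R :> R by rewrite ltr0n.
have bnd (x y : R) : x <= Rm%:R -> 0 <= y -> (0 < x -> b <= y) -> b * (x / Rm%:R) <= y.
  move=> xR y0 xb; have [/xb by1|x0] := ltrP 0 x.
    apply: le_trans by1; rewrite -[leRHS]mulr1; apply: ler_wpM2l => //.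
    by rewrite ler_pdivrMr // mul1r.
  by apply: le_trans y0; rewrite mulr_ge0_le0 // mulr_le0_ge0 // invr_ge0 ltW.
have W0 r' i' : 0 <= runs_coef r' i' p q by exact: runs_coef_ge0.
elim/ltn_ind: h r i => -[|[|h]] IHh r i E hR.
- have rR : r%:R <= Rm%:R :> R by rewrite ler_nat.
  rewrite /= /after_odd_run after_arc_add.
  have := bnd (0 / 6 + r%:R / 2 - rho%:R / 2) (runs_coef r i p q) _ (W0 _ _) _.
  have rho0 : 0 <= rho%:R :> R by [].
  suff h1 : 0 < 0 / 6 + r%:R / 2 - rho%:R / 2 :> R -> b <= runs_coef r i p q.
    move/(_ _ h1) => B; rewrite mulrAC; apply: ler_wpM2r; [lra|apply: B; lra].
  move=> x0; apply: Hb; last by rewrite E.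
  by rewrite hR andbT -(ler_nat R); lra.
- have rR : (r.+1)%:R <= Rm%:R :> R by rewrite ler_nat.
  rewrite /= arc_step_odd /after_odd_run after_arc_add.
  have E0 : 0 <= after_even_run r i c (p + c) (q + ~~ c).
    by rewrite /after_even_run divr_ge0 // runs_coef_ge0.
  have := bnd (2 * (1 / 6 + r%:R / 2 - rho%:R / 2)) (runs_coef r.+1 i p q) _ (W0 _ _) _.
  have rho0 : 0 <= rho%:R :> R by [].
  rewrite -natr1 in rR.
  suff h1 : 0 < 2 * (1 / 6 + r%:R / 2 - rho%:R / 2) :> R -> b <= runs_coef r.+1 i p q.
    move/(_ _ h1) => B; have {}B := B ltac:(lra).
    rewrite -mulrA in B.
    by rewrite (mulrC b) -mulrA; lra.
  move=> x0; apply: Hb; last by lia.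
  suff : (rho < r.+2)%N by lia.
  by rewrite -(ltr_nat R) -(@natr1 _ r.+1) -(@natr1 _ r); lra.
rewrite iter_after_odd_run.
have H1 := IHh h.+1 (ltnSn _) r.+1 i ltac:(lia) ltac:(lia).
have H2 := IHh h (ltnW (ltnSn _)) r i.+1 ltac:(lia) ltac:(lia).
have EK X : b / 2 * (X / Rm%:R) = b / 2 / Rm%:R * X by rewrite mulrA mulrAC.
rewrite !EK in H1 H2 *.
set K := b / 2 / Rm%:R in H1 H2 *.
rewrite -(@natr1 _ h.+1) -(@natr1 _ h).
rewrite -(@natr1 _ h) -(@natr1 _ r) in H1.
lra.
Qed.

(** The first turn is a coin with probability 1/2, after which the walker is on the
first arc of a stretch; that event is the only one kept. *)
Lemma arc_law_ge (p q rho Rm : nat) (b : R) h c0 c :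
  0 <= b -> (0 < Rm)%N ->
  (forall r i, (rho <= r <= Rm)%N -> (p + q = r + 2 * i)%N -> b <= runs_coef r i p q) ->
  (p + q = h)%N -> (h <= Rm)%N ->
  b / 4 * ((h%:R / 6 - rho%:R / 2) / Rm%:R) <=
  arc_law R c0 h.+1 c (p + c) (q + ~~ c).
Proof.
move=> b0 Rm0 Hb E hR.
have H := @after_odd_run_ge p q rho Rm b h 0 0 c b0 Rm0 Hb ltac:(lia) ltac:(lia).
rewrite mul0r addr0 in H.
pose F c p q : R := 2^-1 * after_odd_run 0 0 c p q + 0 * after_odd_run 0 0 c p q.
have LF : iter h (@arc_step R) F c (p + c) (q + ~~ c) <=
          arc_law R c0 h.+1 c (p + c) (q + ~~ c).
  rewrite /arc_law iterSr; apply: iter_arc_step_le => c' p' q'.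
  rewrite /F /after_odd_run /arc_step.
  have [[p1 [q1 [-> -> _]]]|E'] := after_arcP R c' (fun _ _ => 0) p' q'; last first.
    by rewrite !E'; lra.
  rewrite !after_arc_add /runs_coef addn0 andbT.
  case: eqP => [E1|_]; last by rewrite !mul0r addr0 mulr0 addr_ge0 // divr_ge0 ?addr_ge0.
  have [-> ->] : p1 = 0%N /\ q1 = 0%N by lia.
  by rewrite !eqxx bin0 !andbT; case: c'; case: c0 => /=; lra.
apply: le_trans LF; rewrite iter_arc_step_linear; lra.
Qed.
End Runs.

(** With at least [rho = 8 * (p - q)^2 + 1] signs, [bin_ge] applies to the surplus
[p - q]; by the hypothesis on [p + q], [rho] is at most a sixth of the number of
turns, which [after_odd_run_ge] tolerates. *)
Lemma arc_law_ge_sqrt (R : realFieldType) (p q : nat) (s : R) c0 c :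
  (q <= p)%N -> (6 * (8 * (p - q) ^ 2).+1 <= p + q)%N ->
  0 < s -> (p + q)%:R <= s ^+ 2 ->
  (384 * s)^-1 <= arc_law R c0 (p + q).+1 c (p + c) (q + ~~ c).
Proof.
move=> qp hpq s0 hs; set h := (p + q)%N in hpq hs *.
pose rho := (8 * (p - q) ^ 2).+1.
have h0 : (0 < h)%N by lia.
have b0 : 0 <= (8 * s)^-1 by rewrite invr_ge0 mulr_ge0 // ltW.
apply: le_trans (@arc_law_ge R p q rho h (8 * s)^-1 h c0 c b0 h0 _ erefl (leqnn _)).
  have hR : 0 < h%:R :> R by rewrite ltr0n.
  have h2 : 6 * rho%:R <= h%:R :> R by rewrite -natrM ler_nat.
  have -> : (384 * s)^-1 = (8 * s)^-1 / 4 * (1 / 12) by field; rewrite lt0r_neq0.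
  apply: ler_wpM2l; first by rewrite divr_ge0.
  by rewrite ler_pdivlMr //; lra.
move=> r i /andP[rr rh] E; rewrite /runs_coef.
have ip : (i <= p)%N by lia.
rewrite E eqxx ip /= ler_pdivlMr ?exprn_gt0 // mulrC ler_pdivrMr ?mulr_gt0 //.
have e1 : ((p - i).*2 - r = p - q)%N by lia.
apply: bin_ge => //; rewrite ?e1; [lia| |lia|].
  by rewrite (_ : r - (p - i).*2 = 0)%N //; lia.
by apply: le_trans hs; rewrite ler_nat.
Qed.

(** * The chain as a mixture of permutations *)

Section Chain.
Variables (R : realType) (n k : nat).
Hypotheses (k_ge2 : (2 <= k)%N) (k_len : (k.+2 <= n)%N).

Lemma hub_proofA : (k.-1 < n)%N. Proof. by lia. Qed.
Lemma hub_proofB : (n.-1 < n)%N. Proof. by lia. Qed.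

(** Idling at a hub is the average of staying and of swapping the hubs, so the
transition matrix is a convex combination of the rotation, the identity and
[hub_swap], with weights 1/2, 1/4 and 1/4 ([trans_mxE]). *)
Definition hub_swap : {perm 'I_n} := tperm (Ordinal hub_proofA) (Ordinal hub_proofB).

Local Notation P := (trans_mx R n k).

Lemma val_hub_swap (i : 'I_n) : hub_swap i =
  (if i == k.-1 :> nat then n.-1 else if i == n.-1 :> nat then k.-1 else i) :> nat.
Proof.
rewrite /hub_swap; case: tpermP => [->|->|/eqP ia /eqP ib] /=.
- by rewrite eqxx.
- by rewrite eqxx ifF //; lia.
- by rewrite -!val_eqE /= in ia ib; rewrite (negbTE ia) (negbTE ib).
Qed.

Lemma val_ordS (i : 'I_n) : ordS i = (if i == n.-1 :> nat then 0%N else i.+1) :> nat.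
Proof.
rewrite /=; case: eqP => [->|]; first by rewrite prednK ?modnn //; lia.
by move=> ?; rewrite modn_small //; have := ltn_ord i; lia.
Qed.

Lemma trans_mxE (i j : 'I_n) : P i j =
  (ordS i == j)%:R / 2 + (i == j)%:R / 4 + (hub_swap i == j)%:R / 4.
Proof.
rewrite mxE /trans_prob /next_label /is_hub -!val_eqE /= val_hub_swap.
have := val_ordS i; rewrite /= => ->.
have hi := ltn_ord i; have hj := ltn_ord j.
move: (nat_of_ord i) (nat_of_ord j) hi hj => {}i {}j hi hj.
rewrite !eqSS.
have -> : (i.+1 == n) = (i == n.-1) by lia.
have -> : (j.+1 == n) = (j == n.-1) by lia.
have -> : (i.+1 == k) = (i == k.-1) by lia.
have -> : (j.+1 == k) = (j == k.-1) by lia.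
by case: (eqVneq i k.-1) => ?; case: (eqVneq i n.-1) => ? /=;
  repeat (case: eqP => ? /=; try (exfalso; lia)); lra.
Qed.

Lemma trans_mx_ge0 i j : 0 <= P i j.
Proof. by rewrite trans_mxE !addr_ge0 ?divr_ge0. Qed.

Lemma power_trans_mx_ge0 t i j : 0 <= (P ^+ t) i j.
Proof.
elim: t i j => [|t IHt] i j; first by rewrite expr0 mxE; case: eqP.
by rewrite exprS mxE sumr_ge0 // => z _; rewrite mulr_ge0 // trans_mx_ge0.
Qed.

Lemma sum_eq_mul (f : 'I_n -> R) a : \sum_i f i * (i == a)%:R = f a.
Proof.
by rewrite (bigD1 a) //= eqxx mulr1 big1 ?addr0 // => i /negPf->; rewrite mulr0.
Qed.

Lemma trans_mxE_col i j : P i j =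
  (i == ord_pred j)%:R / 2 + (i == j)%:R / 4 + (i == hub_swap j)%:R / 4.
Proof.
rewrite trans_mxE; congr (_%:R / _ + _ + _%:R / _).
  by rewrite -{1}(ord_predK j) (inj_eq (@ordS_inj n)).
by rewrite -{1}(tpermK _ _ j : hub_swap (hub_swap j) = j) (inj_eq perm_inj).
Qed.

Lemma trans_mx_move j : 2^-1 <= P (ord_pred j) j.
Proof.
rewrite trans_mxE_col eqxx /=.
have := ler0n R (ord_pred j == j); have := ler0n R (ord_pred j == hub_swap j); lra.
Qed.

Lemma trans_mx_stay j : hub_swap j = j -> 2^-1 <= P j j.
Proof. by move=> E; rewrite trans_mxE_col E eqxx /=; have := ler0n R (j == ord_pred j); lra. Qed.

Lemma sum_trans_mx_col (f : 'I_n -> R) j : \sum_i f i * P i j =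
  f (ord_pred j) / 2 + f j / 4 + f (hub_swap j) / 4.
Proof.
under eq_bigr do rewrite trans_mxE_col !mulrDr !mulrA.
by rewrite !big_split /= -!mulr_suml !sum_eq_mul.
Qed.

Lemma power_trans_mxS t x j : (P ^+ t.+1) x j =
  (P ^+ t) x (ord_pred j) / 2 + (P ^+ t) x j / 4 + (P ^+ t) x (hub_swap j) / 4.
Proof. by rewrite exprSr mxE sum_trans_mx_col. Qed.

Lemma sum_trans_mx_row i : \sum_j P i j = 1.
Proof.
under eq_bigr do rewrite trans_mxE.
have E (a : 'I_n) : \sum_j (a == j)%:R = 1 :> R.
  by rewrite -[RHS](sum_eq_mul (fun=> 1) a); apply: eq_bigr => j _; rewrite mul1r eq_sym.
by rewrite !big_split /= -!mulr_suml !E; lra.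
Qed.

Lemma sum_power_trans_mx t i : \sum_j (P ^+ t) i j = 1.
Proof.
elim: t i => [|t IHt] i.
  rewrite expr0 -[RHS](sum_eq_mul (fun=> 1) i).
  by apply: eq_bigr => j _; rewrite mxE mul1r eq_sym.
rewrite exprSr; under eq_bigr do rewrite mxE.
rewrite exchange_big /= -(IHt i); apply: eq_bigr => j _.
by rewrite -mulr_sumr sum_trans_mx_row mulr1.
Qed.

Lemma unif_dist_stationary t : unif_dist R n *m P ^+ t = unif_dist R n.
Proof.
elim: t => [|t IHt]; first by rewrite expr0 mulmx1.
rewrite exprSr -[(_ * _)%R]/(_ *m _) mulmxA IHt.
apply/rowP => j; rewrite mxE (sum_trans_mx_col (fun i => unif_dist R n 0 i)) !mxE.
by field; rewrite pnatr_eq0; lia.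
Qed.

Variable x0 : 'I_n.
Local Notation last_pos c := (if c then k.-2 else (n - k).-2)%N.

(** Positions on arc [c] run from 0 to [(last_pos c).+1], which is the hub; [x0]
fills the range beyond. *)
Definition vertex (c : bool) (e : nat) : 'I_n := insubd x0 (if c then e else k + e)%N.

Lemma val_vertex c e : (e <= (last_pos c).+1)%N ->
  vertex c e = (if c then e else k + e)%N :> nat.
Proof. by move=> he; rewrite val_insubd ifT //; case: c he; lia. Qed.

Lemma ord_pred_vertexS c e : (e <= last_pos c)%N -> ord_pred (vertex c e.+1) = vertex c e.
Proof.
move=> he; apply: (@ordS_inj n); rewrite ord_predK; apply: ord_inj.
by case: c he => he; rewrite val_ordS !val_vertex /=; try lia; case: eqP; lia.
Qed.

Lemma ord_pred_vertex0 c : ord_pred (vertex c 0) = vertex (~~ c) (last_pos (~~ c)).+1.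
Proof.
apply: (@ordS_inj n); rewrite ord_predK; apply: ord_inj.
by case: c; rewrite val_ordS !val_vertex //=; case: eqP; lia.
Qed.

Lemma hub_swap_vertex c e : (e <= last_pos c)%N -> hub_swap (vertex c e) = vertex c e.
Proof.
move=> he; apply: ord_inj; rewrite val_hub_swap.
by case: c he => he; rewrite !val_vertex /=; try lia; do 2 ?case: eqP => ?; lia.
Qed.

Lemma hub_swap_hub c :
  hub_swap (vertex c (last_pos c).+1) = vertex (~~ c) (last_pos (~~ c)).+1.
Proof.
by apply: ord_inj; rewrite val_hub_swap; case: c; rewrite !val_vertex //=;
  do 2 ?case: eqP => ?; lia.
Qed.

Lemma vertex_surj (j : 'I_n) : exists c e, (e <= (last_pos c).+1)%N /\ j = vertex c e.
Proof.
have hj := ltn_ord j; case: (ltnP j k) => h.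
  exists true, j; split; first by lia.
  by apply: ord_inj; rewrite val_vertex //=; lia.
exists false, (j - k)%N; split; first by lia.
by apply: ord_inj; rewrite val_vertex //=; lia.
Qed.

(** With this lemma and [next_vertexP] the hubs need no separate estimate: a single
step connects each of them with other vertices. *)
Lemma prev_vertexP (j : 'I_n) : exists c e, (e <= last_pos c)%N /\ 2^-1 <= P (vertex c e) j.
Proof.
have [c [e [he ->]]] := vertex_surj j; exists c.
move: he; rewrite leq_eqVlt => /orP[/eqP->|he].
  by exists (last_pos c); split=> //; rewrite -ord_pred_vertexS // trans_mx_move.
by exists e; split=> //; rewrite trans_mx_stay // hub_swap_vertex.
Qed.

Lemma next_vertexP (j : 'I_n) : exists c e, (e <= last_pos c)%N /\ 2^-1 <= P j (vertex c e).
Proof.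
have [c [e [he ->]]] := vertex_surj j.
move: he; rewrite leq_eqVlt => /orP[/eqP->|he].
  exists (~~ c), 0%N; split=> //.
  by have := trans_mx_move (vertex (~~ c) 0); rewrite ord_pred_vertex0 negbK.
by exists c, e; split=> //; rewrite trans_mx_stay // hub_swap_vertex.
Qed.

End Chain.

Section ChainBound.
Variables (R : realType) (n k : nat).
Hypotheses (k_ge2 : (2 <= k)%N) (k_len : (k.+2 <= n)%N).
Local Notation P := (trans_mx R n k).
Local Notation last_pos c := (if c then k.-2 else (n - k).-2)%N.

(** The index [m] is the number of moves on the trajectory, less one for each of
the [(p + q).+1] hubs passed, [t] is the time less one step for each of them, and
[w] bounds the distance of twice the lower index of the binomial coefficient from
[t], whatever the number of coins. *)
Lemma power_trans_mx_vertex_ge (x : 'I_n) c0 e0 c e p q t m w (s s' : R) :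
  (e0 <= last_pos c0)%N -> (e <= last_pos c)%N ->
  m = (last_pos c0 - e0 + p * k.-1 + q * (n - k).-1 + e.+1)%N ->
  (q <= p)%N -> (6 * (8 * (p - q) ^ 2).+1 <= p + q)%N ->
  0 < s' -> (p + q)%:R <= s' ^+ 2 ->
  (0 < t)%N -> (8 * w ^ 2 <= t)%N -> (t <= m.*2 + w)%N ->
  ((m + (p + q).+1).*2 <= t + w)%N -> 0 < s -> t%:R <= s ^+ 2 ->
  (3072 * (s * s'))^-1 <=
  (P ^+ (t + (p + q).+1)) (vertex n k x c0 e0) (vertex n k x c e).
Proof.
move=> he0 he Em qp hpq s'0 hs' t0 hw tm1 tm2 s0 hs.
set h := (p + q)%N in hpq hs' tm2 *.
set x0 := vertex n k x c0 e0.
pose g t c e := 2 ^+ t * (P ^+ t) x0 (vertex n k x c e).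
have P0 t' i j : 0 <= (P ^+ t') i j by exact: power_trans_mx_ge0.
have g0 t' c' e' : 0 <= g t' c' e' by rewrite /g mulr_ge0 ?exprn_ge0.
have W := @walk_ge R k.-2 (n - k).-2 e0 (last_pos c0 - e0) c0 g g0 ltac:(lia).
have {}W := W _ _ _ _ t h c p q e he.
have {W}W : path_weight R t c0 h.+1 c (p + c) (q + ~~ c) m <= g (t + h.+1)%N c e.
  rewrite Em (_ : k.-1 = k.-2.+1); last by lia.
  rewrite (_ : (n - k).-1 = (n - k).-2.+1); last by lia.
  apply: W.
  - by rewrite /g expr0 mul1r expr0 mxE eqxx.
  - move=> t' c' e' he'; rewrite /g exprS (@power_trans_mxS R n k k_ge2 k_len).
    rewrite ord_pred_vertexS //; last by lia.
    rewrite hub_swap_vertex //.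
    have e2 : 0 <= 2 ^+ t' :> R by rewrite exprn_ge0.
    by rewrite -subr_ge0; nra.
  - move=> t' c'; rewrite /g exprS (@power_trans_mxS R n k k_ge2 k_len).
    rewrite ord_pred_vertex0 // hub_swap_vertex //; lra.
  - move=> t' c'; rewrite /g exprS (@power_trans_mxS R n k k_ge2 k_len).
    rewrite ord_pred_vertexS // hub_swap_hub //.
    by case: c'; rewrite /=; lra.
have B : 2 ^+ t / (8 * s) * 2 ^+ h.+1 *
    arc_law R c0 h.+1 c (p + c) (q + ~~ c) <= g (t + h.+1)%N c e.
  apply: le_trans W; apply: path_weight_ge => i ih.
  rewrite ler_pdivrMr ?mulr_gt0 //; apply: bin_ge => //.
    have : ((m + i).*2 - t <= w)%N by lia.
    by move=> l; apply: leq_trans hw; rewrite leq_mul2l leq_sqr l.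
  have : (t - (m + i).*2 <= w)%N by lia.
  by move=> l; apply: leq_trans hw; rewrite leq_mul2l leq_sqr l.
have A := @arc_law_ge_sqrt R p q s' c0 c qp hpq s'0 hs'.
move: B; rewrite /g exprD.
set X := (P ^+ _) _ _; set L := arc_law _ _ _ _ _ _ in A *.
have e1 : 0 < 2 ^+ t :> R by rewrite exprn_gt0.
have e2 : 0 < 2 ^+ h.+1 :> R by rewrite exprn_gt0.
rewrite (_ : _ * L = 2 ^+ t * 2 ^+ h.+1 * ((8 * s)^-1 * L)); last by ring.
rewrite ler_pM2l ?mulr_gt0 // => B.
apply: le_trans B; rewrite (_ : _^-1 = (8 * s)^-1 * (384 * s')^-1); last first.
  by field; rewrite !lt0r_neq0.
by apply: ler_wpM2l => //; rewrite invr_ge0 mulr_ge0 // ltW.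
Qed.

Lemma power_trans_mx_ge_all (x : 'I_n) (b : R) t :
  (forall c0 e0 c e, (e0 <= last_pos c0)%N -> (e <= last_pos c)%N ->
    b <= (P ^+ t) (vertex n k x c0 e0) (vertex n k x c e)) ->
  forall i j, b / 4 <= (P ^+ t.+2) i j.
Proof.
move=> H i j.
have P0 t' i' j' : 0 <= (P ^+ t') i' j' by exact: power_trans_mx_ge0.
have [c0 [e0 [he0 H0]]] := @next_vertexP R n k k_ge2 k_len x i.
have [c [e [he H1]]] := @prev_vertexP R n k k_ge2 k_len x j.
have Hb := H c0 e0 c e he0 he.
have P1 i' j' : 0 <= P i' j' by exact: trans_mx_ge0.
have E1 v : P i v * (P ^+ t.+1) v j <= (P ^+ t.+2) i j.
  rewrite [P ^+ t.+2]exprS [leRHS]mxE (bigD1 v) //= lerDl.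
  by apply: sumr_ge0 => y _; rewrite mulr_ge0.
have E2 u v : (P ^+ t) u v * P v j <= (P ^+ t.+1) u j.
  rewrite exprSr [leRHS]mxE (bigD1 v) //= lerDl.
  by apply: sumr_ge0 => y _; rewrite mulr_ge0.
apply: le_trans (E1 (vertex n k x c0 e0)).
rewrite (_ : b / 4 = 2^-1 * (b / 2)); last by field.
have [b0|b0] := lerP 0 b; last first.
  by apply: le_trans (mulr_ge0 (P1 _ _) (P0 _ _ _)); lra.
apply: ler_pM => //; first by rewrite divr_ge0.
apply: le_trans (E2 _ (vertex n k x c e)).
by apply: ler_pM.
Qed.

End ChainBound.

(** * Multiples of a badly approximable number *)

Section Diophantine.
Local Open Scope nat_scope.

Definition nat_dist (x y : nat) : nat := (x - y) + (y - x).

Lemma nat_distMl c x y : nat_dist (c * x) (c * y) = c * nat_dist x y.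
Proof. by rewrite /nat_dist -!mulnBr -mulnDr. Qed.

(** Dirichlet's theorem by the pigeonhole principle, with the fraction reduced. *)
Lemma dirichlet_approx N n k : 0 < N -> 0 < n ->
  exists b a, [/\ 0 < b <= N, coprime a b & N * nat_dist (b * k) (a * n) < n].
Proof.
move=> N0 n0.
have box (m : 'I_N.+1) : (N * ((m * k) %% n)) %/ n < N.
  by rewrite ltn_divLR // ltn_pmul2l // ltn_mod.
pose f m := Ordinal (box m).
have [x [y [xy fxy]]] : exists x y : 'I_N.+1, x < y /\ f x = f y.
  have : ~~ injectiveb f.
    by apply/negP => /injectiveP /leq_card; rewrite !card_ord ltnn.
  case/injectivePn => x [y xy fxy].
  case: (ltngtP x y) xy => [lt _|gt _|/ord_inj->]; last by rewrite eqxx.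
    by exists x, y.
  by exists y, x.
move/(congr1 val): fxy => /= fxy.
have ex := divn_eq (x * k) n; have ey := divn_eq (y * k) n.
have fx := divn_eq (N * ((x * k) %% n)) n; have fy := divn_eq (N * ((y * k) %% n)) n.
have mx := ltn_pmod (N * ((x * k) %% n)) n0; have my := ltn_pmod (N * ((y * k) %% n)) n0.
have uxy : x * k %/ n <= y * k %/ n by rewrite leq_div2r // leq_mul2r (ltnW xy) orbT.
pose b := (y - x)%N; pose a := (y * k %/ n - x * k %/ n)%N.
have b0 : 0 < b by rewrite subn_gt0.
have bN : b <= N by have := ltn_ord y; lia.
have close : N * nat_dist (b * k) (a * n) < n.
  have -> : nat_dist (b * k) (a * n) = nat_dist ((y * k) %% n) ((x * k) %% n).
    have xyk : x * k <= y * k by rewrite leq_mul2r (ltnW xy) orbT.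
    have uxyn : x * k %/ n * n <= y * k %/ n * n by rewrite leq_mul2r uxy orbT.
    rewrite /b /a !mulnBl; clear - ex ey xyk uxyn; rewrite /nat_dist.
    move: (x * k %/ n * n) (y * k %/ n * n) (x * k %% n) (y * k %% n)
      (x * k) (y * k) ex ey xyk uxyn; lia.
  rewrite -nat_distMl fx fy fxy /nat_dist; clear - mx my.
  move: (N * (y * k %% n) %/ n * n) (N * (y * k %% n) %% n) (N * (x * k %% n) %% n) mx my.
  lia.
have g0 : 0 < gcdn a b by rewrite gcdn_gt0 b0 orbT.
exists (b %/ gcdn a b), (a %/ gcdn a b).
have eb := divnK (dvdn_gcdr a b); have ea := divnK (dvdn_gcdl a b).
split.
- rewrite divn_gt0 // dvdn_leq ?dvdn_gcdr //=.
  exact: leq_trans (leq_div _ _) bN.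
- by rewrite /coprime -(eqn_pmul2r g0) muln_gcdl eb ea mul1n.
- apply: leq_ltn_trans close; rewrite leq_mul2l.
  have -> : b * k = gcdn a b * (b %/ gcdn a b * k) by rewrite -{1}eb mulnA (mulnC (gcdn a b)).
  have -> : a * n = gcdn a b * (a %/ gcdn a b * n) by rewrite -{1}ea mulnA (mulnC (gcdn a b)).
  by rewrite nat_distMl leq_pmull ?orbT.
Qed.

(** No fraction [a / b] with [1 <= b <= N / 16] satisfies
[|b * k - a * n| < n / N].  The index [i] is [b - 1], and numerators above [b]
are left out since they cannot occur for [k < n]. *)
Definition badly_approximable N n k : bool :=
  [forall i : 'I_(N %/ 16), [forall a : 'I_i.+2,
     n <= N * nat_dist (i.+1 * k) (a * n)]].

(** Let [a / b] be the fraction given by [dirichlet_approx]; then [b > N / 16].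
Replacing [k] by [a * n / b] changes the multiples [u * k], [u < b], by less than
[n / N], and since [a] is invertible modulo [b] it turns them into all multiples of
[n / b] modulo [n].  Both errors together are at most [n / N + n / b]. The size
of [z] makes the number [q] of full turns nonnegative. *)
Lemma multiples_dense N n k z : 0 < N -> k < n -> badly_approximable N n k ->
  n * N.+1 <= z ->
  exists d q, d < N /\ N * nat_dist (d * k + q * n) z <= 17 * n.
Proof.
move=> N0 kn good zn.
have n0 : 0 < n by lia.
have [b [a [/andP[b0 bN] cab close]]] := dirichlet_approx N n k N0 n0.
have ab : a <= b.
  rewrite -ltnS -(ltn_pmul2r n0).
  have h1 : b * k <= b * n by rewrite leq_mul2l (ltnW kn) orbT.
  have h2 : nat_dist (b * k) (a * n) < n by nia.
  by move: h2; rewrite /nat_dist; nia.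
have Nb : N <= 16 * b.
  case: (leqP N (16 * b)) => // bs; exfalso.
  have hb : b.-1 < N %/ 16 by rewrite leq_divRL //; lia.
  have ha : a < b.-1.+2 by lia.
  have := forallP (forallP good (Ordinal hb)) (Ordinal ha).
  by rewrite /= prednK // leqNgt close.
pose rho := (z * b) %/ n; have Ez := divn_eq (z * b) n; rewrite -/rho in Ez.
have hr := ltn_pmod (z * b) n0.
have [d [db Ed]] : exists d, d < b /\ d * a = rho %[mod b].
  pose x := chinese a b 0 rho.
  have xa : a %| x by rewrite /dvdn (chinese_modl cab) mod0n.
  exists ((x %/ a) %% b); split; first by rewrite ltn_mod.
  by rewrite modnMml divnK // chinese_modr.
have rge : b * N.+1 <= rho.
  by rewrite /rho leq_divRL //; nia.
have dar : d * a <= rho.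
  apply: leq_trans rge; rewrite mulnC; apply: leq_mul => //; lia.
have [q Eq] : exists q, rho = d * a + q * b.
  exists ((rho - d * a) %/ b); rewrite divnK ?subnKC //.
  by rewrite -eqn_mod_dvd // eq_sym; apply/eqP.
exists d, q; split; first by lia.
rewrite -(leq_pmul2l b0).
have key : nat_dist (b * (d * k + q * n)) (b * z) <= d * nat_dist (b * k) (a * n) + n.
  rewrite -nat_distMl (mulnC b z) Ez Eq !mulnDr !mulnDl /nat_dist.
  have -> : b * (q * n) = q * b * n by ring.
  have -> : b * (d * k) = d * (b * k) by ring.
  have -> : d * a * n = d * (a * n) by ring.
  lia.
have -> : b * (N * nat_dist (d * k + q * n) z) = N * nat_dist (b * (d * k + q * n)) (b * z).
  by rewrite nat_distMl mulnCA.
apply: leq_trans (_ : N * (d * nat_dist (b * k) (a * n) + n) <= _); first by rewrite leq_mul2l key orbT.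
have h1 : d * (N * nat_dist (b * k) (a * n)) <= b * n by apply: leq_mul; lia.
have h2 : N * n <= 16 * b * n by rewrite leq_mul2r Nb orbT.
by rewrite mulnDr (mulnCA N d); lia.
Qed.

Lemma count_exists (T : Type) (I : finType) (E : I -> pred T) (s : seq T) :
  count (fun x => [exists i, E i x]) s <= \sum_i count (E i) s.
Proof.
elim: s => [|x s IHs] //=.
rewrite big_split /=; apply: leq_add => //.
case: existsP => // -[i Ei]; rewrite (bigD1 i) //= Ei; exact: leq_addr.
Qed.

(** All elements lie in an interval of [L + 1] integers starting at the least one. *)
Lemma count_diam (E : pred nat) (s : seq nat) L : uniq s ->
  (forall x y, E x -> E y -> x <= y + L) -> count E s <= L.+1.
Proof.
move=> us HE; rewrite -size_filter.
case: (posnP (size [seq x <- s | E x])) => [-> //|].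
rewrite -has_predT => /hasP[x0]; rewrite mem_filter => /andP[Ex0 _] _.
have exE : exists x, E x by exists x0.
case: (ex_minnP exE) => m Em mmin.
rewrite -[L.+1](size_iota m); apply: uniq_leq_size; first exact: filter_uniq.
move=> x; rewrite mem_filter mem_iota => /andP[Ex _].
by rewrite mmin //= addnS ltnS HE.
Qed.

(** For given [a] and [b] the bad [k] lie in an interval of length [2 n / (b N)];
there are [b + 1] values of [a], so each [b] contributes at most [4 n / N + N]. *)
Lemma count_approximable N n (s : seq nat) : 16 <= N -> 0 < n -> uniq s ->
  16 * count (fun k => ~~ badly_approximable N n k) s <= 4 * n + N ^ 2.
Proof.
move=> N16 n0 us.
pose E (i : 'I_(N %/ 16)) (a : 'I_i.+2) k := N * nat_dist (i.+1 * k) (a * n) < n.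
have -> : count (fun k => ~~ badly_approximable N n k) s =
    count (fun k => [exists i, [exists a, E i a k]]) s.
  apply: eq_count => k; rewrite /badly_approximable negb_forall; apply: eq_existsb => i.
  by rewrite negb_forall; apply: eq_existsb => a; rewrite /E -ltnNge.
apply: leq_trans (_ : 16 * (\sum_(i < N %/ 16) (4 * n %/ N + N)) <= _); last first.
  rewrite sum_nat_const card_ord mulnA (mulnC 16).
  apply: leq_trans (leq_mul (leq_trunc_div N 16) (leqnn _)) _.
  by rewrite mulnDr leq_add // mulnC leq_trunc_div.
rewrite leq_mul2l /=; apply: leq_trans (count_exists _ _ _ _) _.
apply: leq_sum => i _.
apply: leq_trans (count_exists _ _ _ _) _.
have iN := ltn_ord i; rewrite leq_divRL // in iN.
pose L := (2 * n) %/ (i.+1 * N).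
apply: leq_trans (_ : \sum_(a < i.+2) L.+1 <= _).
  apply: leq_sum => a _; apply: count_diam => // x y.
  rewrite /E /L => Ex Ey; rewrite -leq_subLR leq_divRL ?muln_gt0 ?ltn0Sn //; last by lia.
  rewrite -!nat_distMl /nat_dist in Ex Ey; rewrite mulnBl.
  have -> : x * (i.+1 * N) = N * (i.+1 * x) by ring.
  have -> : y * (i.+1 * N) = N * (i.+1 * y) by ring.
  lia.
rewrite sum_nat_const card_ord mulnS addnC; apply: leq_add; last by lia.
apply: leq_trans (_ : i.+1.*2 * L <= _); first by rewrite leq_mul2r; lia.
rewrite leq_divRL; last by lia.
have := leq_trunc_div (2 * n) (i.+1 * N); rewrite -/L => h.
by rewrite -muln2 -!mulnA (mulnC 2) mulnA; nia.
Qed.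

(** Here [N] is the fourth root of [n] up to a constant, the time is
[(256 * N^3)^2], hence the expected number of moves is [2 * (128 * N^3)^2], and
[d] is, up to one, the number of moves made outside the [p + q] complete arcs.  The
walker needs about [d + q * n + u * k] moves in total with [u = p - q], and [u < N]
is chosen by [multiples_dense] to bring this close to the expected number. *)
Lemma rounds_exist N n k d : 256 * 257 <= N -> N ^ 4 <= n -> n <= 2 * N ^ 4 ->
  k < n -> badly_approximable N n k -> d <= 2 * n ->
  exists p q, [/\ q <= p, 6 * (8 * (p - q) ^ 2).+1 <= p + q,
    p + q <= (257 * N) ^ 2, p + q + 3 <= 2 * N ^ 3 &
    nat_dist (d + p * k + q * (n - k)) (2 * (128 * N ^ 3) ^ 2) <= 34 * N ^ 3].
Proof.
move=> NL Nn nN kn good dn.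
have N0 : 0 < N by lia.
have [Y EY] : exists Y, N ^ 4 = Y by exists (N ^ 4).
have Y0 : 0 < Y by rewrite -EY expn_gt0 N0.
rewrite EY in Nn nN.
have EX : 2 * (128 * N ^ 3) ^ 2 = 2 * 128 * 128 * (N * N) * Y by rewrite -EY; ring.
have EA : N ^ 3 * N = Y by rewrite -EY; ring.
have A1 : N ^ 3 <= Y by rewrite -EA leq_pmulr.
have NN : 256 * 257 * N <= N * N by rewrite leq_mul2r NL orbT.
have NNY : 256 * 257 * (N * Y) <= N * N * Y.
  by rewrite mulnA; rewrite leq_mul2r NN orbT.
have NY : 256 * 257 * Y <= N * Y by rewrite leq_mul2r NL orbT.
have nNle : n * N <= 2 * (N * Y) by rewrite mulnC mulnCA leq_mul2l nN orbT.
pose z := 2 * (128 * N ^ 3) ^ 2 - d.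
have zle : n * N.+1 <= z.
  by rewrite /z EX mulnS; lia.
have [u [q [uN close]]] := @multiples_dense N n k z N0 kn good zle.
have {}close : nat_dist (u * k + q * n) z <= 34 * N ^ 3.
  rewrite -(leq_pmul2l N0); apply: leq_trans close _.
  by rewrite mulnCA (mulnC N) EA; lia.
have dz : d + z = 2 * 128 * 128 * (N * N) * Y.
  by rewrite /z EX subnKC //; lia.
have [cu cl] : d + u * k + q * n <= 2 * 128 * 128 * (N * N) * Y + 34 * Y /\
    2 * 128 * 128 * (N * N) * Y <= d + u * k + q * n + 34 * Y.
  by clear - close dz A1; move: close dz; rewrite /nat_dist; lia.
have uk : u * k <= N * n by apply: leq_mul; lia.
have ub : 2 * q <= 256 * 256 * (N * N) + 68.
  rewrite -(leq_pmul2r Y0).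
  have : q * Y <= q * n by rewrite leq_mul2l Nn orbT.
  clear - cu; lia.
have lb : 256 * 128 * (N * N) <= 2 * q + 2 * N + 38.
  rewrite -(leq_pmul2r Y0).
  have : q * n <= q * (2 * Y) by rewrite leq_mul2l nN orbT.
  clear - cl uk nNle nN dn; lia.
have NNA : 256 * 257 * (N * N) <= N ^ 3.
  by rewrite (_ : N ^ 3 = N * (N * N)) ?leq_mul2r ?NL ?orbT // !expnS muln1.
exists (q + u)%N, q; split.
- by rewrite leq_addr.
- rewrite addKn.
  have : u ^ 2 <= N * N by rewrite -mulnn leq_mul // ltnW.
  lia.
- rewrite (_ : (257 * N) ^ 2 = 257 * 257 * (N * N)); last by ring.
  lia.
- lia.
- have -> : d + (q + u) * k + q * (n - k) = d + (u * k + q * n).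
    by rewrite mulnBr mulnDl; have : q * k <= q * n; [rewrite leq_mul2l (ltnW kn) orbT|lia].
  by clear - close dz EX; rewrite EX; move: close dz; rewrite /nat_dist; lia.
Qed.

End Diophantine.

(** * Geometric convergence from a uniform minorization *)

(** On vectors of zero sum, [M] acts like [M] with the constant [a] subtracted from
all entries, which is a nonnegative matrix with row sums [1 - n * a]. *)
Lemma doeblin_contraction (R : realFieldType) n (M : 'M[R]_n) (a : R) (u : 'rV[R]_n) :
  (forall i j, a <= M i j) -> (forall i, \sum_j M i j = 1) -> \sum_i u 0 i = 0 ->
  \sum_j `|(u *m M) 0 j| <= (1 - n%:R * a) * \sum_i `|u 0 i|.
Proof.
move=> aM M1 u0.
apply: le_trans (_ : \sum_j \sum_i `|u 0 i| * (M i j - a) <= _).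
  apply: ler_sum => j _; rewrite mxE.
  have -> : \sum_i u 0 i * M i j = \sum_i u 0 i * (M i j - a).
    under [RHS]eq_bigr do rewrite mulrBr.
    by rewrite sumrB -mulr_suml u0 mul0r subr0.
  apply: le_trans (ler_norm_sum _ _ _) _; apply: ler_sum => i _.
  by rewrite normrM (ger0_norm (x := _ - _)) // subr_ge0.
rewrite exchange_big mulr_sumr; apply: ler_sum => i _ /=.
by rewrite -mulr_sumr sumrB M1 sumr_const card_ord mulr_natl [leRHS]mulrC.
Qed.

Lemma mulmx_sum_row (R : realFieldType) n (M : 'M[R]_n) (u : 'rV[R]_n) :
  (forall i, \sum_j M i j = 1) -> \sum_j (u *m M) 0 j = \sum_i u 0 i.
Proof.
move=> M1; under eq_bigr do rewrite mxE.
by rewrite exchange_big; apply: eq_bigr => i _; rewrite -mulr_sumr M1 mulr1.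
Qed.

Lemma iter_contraction (R : realFieldType) n (M : 'M[R]_n) (c : R) (u : 'rV[R]_n) (j : nat) :
  (0 < n)%N -> c <= 1 ->
  (forall i j, c / n%:R <= M i j) -> (forall i, \sum_j M i j = 1) -> \sum_i u 0 i = 0 ->
  \sum_i `|(u *m M ^+ j) 0 i| <= (1 - c) ^+ j * \sum_i `|u 0 i|.
Proof.
move=> n0 c1 cM M1 u0.
suff [] : \sum_i `|(u *m M ^+ j) 0 i| <= (1 - c) ^+ j * \sum_i `|u 0 i| /\
  \sum_i (u *m M ^+ j) 0 i = 0 by [].
elim: j => [|j [IH1 IH2]]; first by rewrite !expr0 mulmx1 mul1r.
have -> : u *m M ^+ j.+1 = u *m M ^+ j *m M by rewrite -mulmxA exprSr.
rewrite mulmx_sum_row //; split => //.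
apply: le_trans (doeblin_contraction _ _ _ _ _ cM M1 IH2) _.
rewrite (_ : n%:R * (c / n%:R) = c); last by field; rewrite pnatr_eq0 -lt0n.
by rewrite exprS -mulrA; apply: ler_wpM2l => //; lra.
Qed.

Section Mixing.
Variables (R : realType) (n k t0 : nat) (c : R).
Hypotheses (n_gt0 : (0 < n)%N) (c_gt0 : 0 < c) (c_le1 : c <= 1).
Local Notation P := (trans_mx R n k).
Hypothesis row_sum1 : forall t i, \sum_j (P ^+ t) i j = 1.
Hypothesis stationary : forall t, unif_dist R n *m P ^+ t = unif_dist R n.
Hypothesis minorized : forall i j, c / n%:R <= (P ^+ t0) i j.

Lemma chain_dist_le j : chain_dist R n k (t0 * j) <= (1 - c) ^+ j.
Proof.
have cj0 : 0 <= (1 - c) ^+ j by rewrite exprn_ge0 // subr_ge0.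
apply: bigmax_le => // x _; rewrite /tv_dist /chain_law.
set u := delta_mx 0 x - unif_dist R n.
have E : delta_mx 0 x *m P ^+ (t0 * j) - unif_dist R n = u *m (P ^+ t0) ^+ j.
  by rewrite -exprM mulmxBl stationary.
under eq_bigr => y _.
  rewrite (_ : _ - _ = (u *m (P ^+ t0) ^+ j) 0 y); last by rewrite -E !mxE.
  over.
have nR : n%:R != 0 :> R by rewrite pnatr_eq0 -lt0n.
have dsum : \sum_i (delta_mx 0 x : 'rV[R]_n) 0 i = 1.
  rewrite (bigD1 x) //= mxE !eqxx big1 ?addr0 // => i /negPf ix.
  by rewrite mxE ix andbF.
have usum : \sum_(i < n) unif_dist R n 0 i = 1.
  under eq_bigr do rewrite mxE.
  by rewrite sumr_const card_ord -[LHS]mulr_natl mulfV.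
have u0 : \sum_i u 0 i = 0.
  under eq_bigr do rewrite mxE [X in _ + X]mxE.
  by rewrite sumrB dsum usum subrr.
have u2 : \sum_i `|u 0 i| <= 2.
  apply: le_trans (_ : \sum_i ((delta_mx 0 x : 'rV[R]_n) 0 i + unif_dist R n 0 i) <= _).
    apply: ler_sum => i _; rewrite mxE [X in _ + X]mxE.
    apply: le_trans (ler_normB _ _) _.
    by rewrite !ger0_norm // mxE ?invr_ge0.
  by rewrite big_split /= dsum usum.
have H := iter_contraction _ _ _ c u j n_gt0 c_le1 minorized (row_sum1 t0) u0.
apply: le_trans (_ : 1 / 2 * ((1 - c) ^+ j * 2) <= _); last by lra.
by apply: ler_wpM2l => //; apply: le_trans H _; apply: ler_wpM2l.
Qed.

(** The number [j] of blocks of [t0] steps is the first integer above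
[ln (1 / eps) / c].  The rounding costs at most one block, which is at most
[ln (1 / eps) / ln 2] blocks as [eps < 1 / 2]. *)
Lemma t_mix_le (eps : R) : 0 < eps -> eps < 1 / 2 ->
  (t_mix n k eps <= (t0%:R * (c^-1 + (ln 2)^-1) * ln (1 / eps))%:E)%E.
Proof.
move=> e0 e2.
have l0 : ln 2 <= ln (1 / eps) :> R.
  rewrite ler_ln ?posrE ?divr_gt0 //.
  by rewrite ler_pdivlMr //; lra.
have l2 : 0 < ln 2 :> R by rewrite ln_gt0 // ltr1n.
set L := ln (1 / eps) in l0 *.
have Lc0 : 0 <= L / c by rewrite divr_ge0 ?(ltW c_gt0) // (le_trans _ l0) // ltW.
pose j := (Num.truncn (L / c)).+1.
have jL : L / c < j%:R by have := truncn_itv Lc0 => /andP[].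
have jU : j%:R <= L / c + 1.
  by rewrite /j -natr1 lerD2r; have := truncn_itv Lc0 => /andP[].
have small : (1 - c) ^+ j <= eps.
  apply: le_trans (_ : expR (- c) ^+ j <= _).
    apply: lerXn2r; rewrite ?nnegrE ?expR_ge0 ?subr_ge0 //.
    by have := expR_ge1Dx (- c).
  rewrite -expRM_natl -[leRHS]lnK ?posrE // ler_expR.
  have -> : ln eps = - L by rewrite /L div1r lnV ?posrE // opprK.
  by rewrite mulrN lerN2 -ler_pdivrMr // ltW.
apply: le_trans (_ : ((t0 * j)%:R)%:E <= _)%E.
  apply: ereal_inf_lbound; exists (t0 * j)%N => //=.
  exact: le_trans (chain_dist_le j) small.
rewrite lee_fin natrM -mulrA; apply: ler_wpM2l => //.
apply: le_trans jU _; rewrite mulrDl (mulrC c^-1) lerD2l mulrC ler_pdivlMr // mul1r.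
exact: l0.
Qed.
End Mixing.

(** * Assembling the constants *)

Lemma fourth_root (L : nat) : exists n0 : nat, forall n : nat, (n0 <= n)%N ->
  exists N : nat, [/\ (L <= N)%N, (N ^ 4 <= n)%N & (n <= 2 * N ^ 4)%N].
Proof.
exists ((L + 6) ^ 4)%N => n hn.
have ex : exists m : nat, (m ^ 4 <= n)%N by exists (L + 6)%N.
have bound m : (m ^ 4 <= n)%N -> (m <= n)%N.
  by apply: leq_trans; rewrite -{1}[m]expn1; case: m => // m; rewrite leq_pexp2l.
case: (ex_maxnP ex bound) => N hN maxN; exists N.
have LN : (L + 6 <= N)%N by exact: maxN.
split=> //; first by lia.
have : (n < N.+1 ^ 4)%N by rewrite ltnNge; apply/negP => /maxN; rewrite ltnn.
move/ltnW/leq_trans; apply.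
(* [2 * N^4 - (N + 1)^4] has nonnegative coefficients in [m = N - 6]. *)
have [m ->] : exists m, N = (6 + m)%N by exists (N - 6)%N; lia.
have -> : (2 * (6 + m) ^ 4 = (6 + m).+1 ^ 4 + (m ^ 4 + 20 * m ^ 3 + 138 * m ^ 2 + 356 * m + 191))%N.
  by ring.
exact: leq_addr.
Qed.

Lemma sub_in_count (T : eqType) (a1 a2 : pred T) (s : seq T) :
  (forall x, x \in s -> a1 x -> a2 x) -> (count a1 s <= count a2 s)%N.
Proof.
elim: s => //= x s IHs H; apply: leq_add.
  by case: (a1 x) (H x (mem_head _ _)) => // ->.
by apply: IHs => y ys; apply: H; rewrite in_cons ys orbT.
Qed.

(** The constants 256 and 257 bound the square roots of the time and of the number
of arcs in units of [N^3] and [N], 3072 comes from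
[power_trans_mx_vertex_ge] and 4 from [power_trans_mx_ge_all]. *)
Definition minor_const (R : realType) : R := (4 * (3072 * (256 * 257)))^-1.

Lemma minor_const_gt0 (R : realType) : 0 < minor_const R.
Proof. by rewrite invr_gt0; lra. Qed.

Lemma minor_const_le1 (R : realType) : minor_const R <= 1.
Proof. by rewrite /minor_const invf_le1; lra. Qed.

Lemma trans_mx_minorized (R : realType) (n k N : nat) : (256 * 257 <= N)%N ->
  (N ^ 4 <= n)%N -> (n <= 2 * N ^ 4)%N -> (2 <= k)%N -> (k.+2 <= n)%N ->
  badly_approximable N n k ->
  forall i j, minor_const R / n%:R <= (trans_mx R n k ^+ ((256 * N ^ 3) ^ 2).+2) i j.
Proof.
move=> NL Nn nN k2 kn good i j.
have N0 : (0 < N)%N by lia.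
have NR : 0 < N%:R :> R by rewrite ltr0n.
have n0 : (0 < n)%N by lia.
have nR : 0 < n%:R :> R by rewrite ltr0n.
rewrite (_ : minor_const R / n%:R = (3072 * (256 * 257 * n%:R))^-1 / 4); last first.
  by rewrite /minor_const; field; rewrite lt0r_neq0.
apply: (power_trans_mx_ge_all R n k k2 kn i) => c0 e0 c e he0 he.
set last_pos := fun c : bool => if c then k.-2 else (n - k).-2.
have hd : (last_pos c0 - e0 + e.+1 <= 2 * n)%N.
  by move: he0 he; rewrite /last_pos; case: c0; case: c; lia.
have [p [q [qp h1 h2 h3 close]]] := rounds_exist N n k _ NL Nn nN (ltnW kn) good hd.
set h := (p + q)%N in h1 h2 h3.
pose m := (last_pos c0 - e0 + p * k.-1 + q * (n - k).-1 + e.+1)%N.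
have Em : (m + h = last_pos c0 - e0 + e.+1 + p * k + q * (n - k))%N.
  rewrite /m /h; case: (k) k2 kn => // k' _ kn'.
  rewrite (_ : n - k'.+1 = (n - k'.+1).-1.+1)%N; last by lia.
  by rewrite /= !mulnS; lia.
rewrite -Em in close.
have AN : (256 * 257 <= N ^ 3)%N.
  by apply: leq_trans NL _; rewrite -{1}[N]expn1 leq_pexp2l.
have hsq : (256 * 257 * N ^ 3 <= (N ^ 3) ^ 2)%N by rewrite -mulnn leq_mul2r AN orbT.
have ET : ((256 * N ^ 3) ^ 2 = 2 * (2 * (128 * N ^ 3) ^ 2))%N by ring.
have EZ : (2 * (128 * N ^ 3) ^ 2 = 128 * 128 * 2 * (N ^ 3) ^ 2)%N by ring.
pose t := ((256 * N ^ 3) ^ 2 - h.+1)%N.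
have Et : (t + h.+1 = (256 * N ^ 3) ^ 2)%N.
  rewrite /t subnK // ET EZ; clear - h3 hsq.
  by move: ((N ^ 3) ^ 2)%N (N ^ 3)%N h3 hsq; lia.
rewrite -Et.
(* The window is twice the distance [34 * N^3] of [rounds_exist], plus [2 * N^3]
   for the steps that leave the hubs. *)
apply: le_trans (power_trans_mx_vertex_ge R n k k2 kn i c0 e0 c e p q t m
  (70 * N ^ 3) (256 * (N ^ 3)%:R) (257 * N%:R) he0 he erefl qp h1 _ _ _ _ _ _ _ _).
- rewrite lef_pV2 ?posrE ?mulr_gt0 ?ltr0n ?expn_gt0 ?N0 ?n0 //.
  have : (N ^ 3 * N <= n)%N by rewrite (_ : N ^ 3 * N = N ^ 4)%N //; ring.
  rewrite -(ler_nat R) natrM; clear; lra.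
- by rewrite mulr_gt0 ?ltr0n.
- by rewrite -natrM -natrX ler_nat.
- clear - Et ET EZ h3 hsq; rewrite ET EZ in Et.
  by move: ((N ^ 3) ^ 2)%N (N ^ 3)%N h3 hsq Et; lia.
- rewrite (_ : 8 * (70 * N ^ 3) ^ 2 = 8 * 70 * 70 * (N ^ 3) ^ 2)%N; last by ring.
  clear - Et ET EZ h3 hsq; rewrite ET EZ in Et.
  by move: ((N ^ 3) ^ 2)%N (N ^ 3)%N h3 hsq Et; lia.
- have Eh : (p + q)%N = h by []; rewrite ?Eh.
  clearbody m t h; clear - close Et ET h3; rewrite ET in Et.
  by move: close Et; rewrite /nat_dist; move: (2 * (128 * N ^ 3) ^ 2)%N (N ^ 3)%N h3; lia.
- have Eh : (p + q)%N = h by []; rewrite ?Eh.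
  clearbody m t h; clear - close Et ET h3; rewrite ET in Et.
  by move: close Et; rewrite /nat_dist; move: (2 * (128 * N ^ 3) ^ 2)%N (N ^ 3)%N h3; lia.
- by rewrite mulr_gt0 ?ltr0n // expn_gt0 N0.
- by rewrite -natrM -natrX ler_nat -Et leq_addr.
Qed.

Lemma minor_constP (R : realType) : exists c : R, [/\ 0 < c, c <= 1 &
  forall n k N : nat, (256 * 257 <= N)%N ->
    (N ^ 4 <= n)%N -> (n <= 2 * N ^ 4)%N -> (2 <= k)%N -> (k.+2 <= n)%N ->
    badly_approximable N n k ->
    forall i j, c / n%:R <= (trans_mx R n k ^+ ((256 * N ^ 3) ^ 2).+2) i j].
Proof.
exists (minor_const R); split; [exact: minor_const_gt0|exact: minor_const_le1|].
exact: trans_mx_minorized.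
Qed.

Lemma natr_powR_3_2 (R : realType) (N n : nat) : (N ^ 4 <= n)%N ->
  ((N ^ 3) ^ 2)%:R <= n%:R `^ (3 / 2) :> R.
Proof.
move=> Nn.
apply: le_trans (_ : (N ^ 4)%:R `^ (3 / 2) <= _); last first.
  by apply: ge0_ler_powR; rewrite ?nnegrE ?ler_nat // divr_ge0.
rewrite -expnM !natrX -!powR_mulrn // -powRrM.
by rewrite (_ : 4 * (3 / 2) = 6 :> R) //; field.
Qed.

Theorem theorem2 (R : realType) :
  exists gamma gamma' : R, 0 < gamma /\ 0 < gamma' /\
    forall eps : R, 0 < eps -> eps < 1 / 2 ->
      exists N : nat, forall n : nat, (N <= n)%N ->
        gamma <= unif_prob R (index_iota 2 n.-1)
          (fun k : nat =>
             (t_mix n k eps <= (gamma' * n%:R `^ (3 / 2) * ln (1 / eps))%:E)%E).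
Proof.
have [c [c0 c1 minor]] := minor_constP R.
have l2 : 0 < ln 2 :> R by rewrite ln_gt0 // ltr1n.
have K0 : 0 < c^-1 + (ln 2)^-1 :> R by rewrite addr_gt0 ?invr_gt0.
exists (1 / 2), (257 ^+ 2 * (c^-1 + (ln 2)^-1)).
split; [by rewrite divr_gt0|split; first by rewrite mulr_gt0 ?exprn_gt0 ?ltr0n].
move=> eps e0 e2.
have [n0 Hn0] := fourth_root (256 * 257)%N.
exists n0 => n /Hn0[N [NL Nn nN]].
have N0 : (0 < N)%N by lia.
have N2 : (16 * N ^ 2 <= n)%N.
  apply: leq_trans Nn; rewrite (_ : N ^ 4 = N ^ 2 * N ^ 2)%N; last by ring.
  by rewrite leq_mul2r; apply/orP; right; rewrite -mulnn; nia.
have n16 : (16 <= n)%N by apply: leq_trans N2; rewrite -[16%N]muln1 leq_mul // expn_gt0 N0.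
have nR : 0 < n%:R :> R by rewrite ltr0n; lia.
set s := index_iota 2 n.-1.
have size_s : size s = (n - 3)%N by rewrite size_iota; lia.
pose E := badly_approximable N n.
have bad : (16 * count (predC E) s <= 4 * n + N ^ 2)%N.
  by apply: count_approximable; [lia|lia|exact: iota_uniq].
have tot := count_predC E s.
(* By [bad] at most [5 * n / 16] values of [k] are lost, so half of them remain. *)
set F := fun k : nat => _.
have EF : (count E s <= count F s)%N.
  apply: sub_in_count => k; rewrite mem_index_iota => /andP[k2 kn] Ek; rewrite /F.
  have kn2 : (k.+2 <= n)%N by lia.
  have n0' : (0 < n)%N by lia.
  apply: le_trans (t_mix_le R n k ((256 * N ^ 3) ^ 2).+2 c n0' c0 c1
    (sum_power_trans_mx R n k k2 kn2) (unif_dist_stationary R n k k2 kn2)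
    (minor n k N NL Nn nN k2 kn2 Ek) eps e0 e2) _.
  rewrite lee_fin; apply: ler_wpM2r.
    by rewrite ln_ge0 // ler_pdivlMr //; lra.
  rewrite mulrAC; apply: ler_wpM2r; first exact: ltW.
  apply: le_trans (_ : 257 ^+ 2 * ((N ^ 3) ^ 2)%:R <= _); last first.
    by apply: ler_wpM2l; [exact: exprn_ge0|exact: natr_powR_3_2].
  rewrite -natrX -natrM ler_nat.
  have : (0 < (N ^ 3) ^ 2)%N by rewrite !expn_gt0 N0.
  by rewrite !expnMn; lia.
rewrite /unif_prob size_s ler_pdivlMr ?ltr0n; last by lia.
rewrite mul1r mulrC ler_pdivrMr // -natrM ler_nat.
lia.
Qed.
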